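(* For every finite simple graph $G$, the set system $(V(G),\Psi(G))$ is an augmentoid. That is, $\Psi(G)$ is nonempty, and for every $S,T\in\Psi(G)$ there exist sets $A\subseteq S\setminus T$ and $B\subseteq T\setminus S$ such that $T\cup A\in\Psi(G)$, $S\cup B\in\Psi(G)$, and $|T\cup A|=|S\cup B|$.
   Context: For a graph $G$ and $X\subseteq V(G)$, $N(X)$ denotes the set of vertices adjacent to some vertex of $X$ (open neighborhood) and $N[X]=X\cup N(X)$ (closed neighborhood); $G[X]$ is the subgraph induced by $X$. A set $S\subseteq V(G)$ is independent if no two of its vertices are adjacent. A set $S\subseteq V(G)$ is a local maximum independent set of $G$ if $S$ is a maximum independent set of the induced subgraph $G[N[S]]$; $\Psi(G)$ denotes the family of all local maximum independent sets of $G$. A pair $(E,\mathcal F)$ with nonempty $\mathcal F\subseteq 2^E$ is an augmentoid if for every $X,Y\in\mathcal F$ there exist $A\subseteq X\setminus Y$ and $B\subseteq Y\setminus X$ with $Y\cup A\in\mathcal F$, $X\cup B\in\mathcal F$, and $|Y\cup A|=|X\cup B|$. *)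

(* Defs.v *)
From mathcomp Require Import all_boot.

Set Implicit Arguments.
Unset Strict Implicit.
Unset Printing Implicit Defensive.

(* A finite simple graph is a symmetric irreflexive relation on a finType;
   these two conditions are hypotheses of the theorem, not of the
   definitions. *)
Section Graph.

Variables (V : finType) (adj : rel V).
Implicit Types (S U X : {set V}).

Definition open_nbhd X : {set V} := [set v | [exists x in X, adj x v]].

Definition closed_nbhd X : {set V} := X :|: open_nbhd X.

Definition independent S : bool :=
  [forall x in S, forall y in S, ~~ adj x y].

(* The independent sets of the induced subgraph G[U] are the independent
   sets of G that are contained in U. *)
Definition independent_in U S : bool := (S \subset U) && independent S.

Definition maximum_independent_in U S : bool :=
  independent_in U S &&
  [forall I : {set V}, independent_in U I ==> (#|I| <= #|S|)].

Definition Psi : {set {set V}} :=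
  [set S | maximum_independent_in (closed_nbhd S) S].

End Graph.

Definition augmentoid (E : finType) (F : {set {set E}}) : Prop :=
  F != set0 /\
  forall X Y : {set E}, X \in F -> Y \in F ->
    exists A B : {set E},
      [/\ A \subset X :\: Y, B \subset Y :\: X,
          Y :|: A \in F, X :|: B \in F & #|Y :|: A| = #|X :|: B|].

(* Main.v *)
Require Import Defs.
From mathcomp Require Import all_boot.

(** Take A = S \ N[T] and B = T \ N[S].  Exchanging inside N[T] the set
    T ∩ N[S] for S ∩ N[T] keeps T independent, so maximality of T, and then of
    S, gives |S ∩ N[T]| = |T ∩ N[S]|; hence |T ∪ A| = |S ∪ B|.  If I is
    independent in N[T ∪ A] then |I ∩ N[T]| <= |T|, while (I \ N[T]) ∪ (T ∩ N[S])
    is independent in N[S], so |I \ N[T]| <= |S| - |S ∩ N[T]| = |A|. *)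

(** Removing a superset [Z] of [X] makes the two parts disjoint. Below, [Z] is always a closed
    neighborhood. *)
Lemma card_setU_setD (E : finType) (X Y Z : {set E}) :
  X \subset Z -> #|X :|: (Y :\: Z)| = #|X| + #|Y :\: Z|.
Proof.
move=> sXZ; apply/eqP; rewrite (leq_card_setU X (Y :\: Z)).
by rewrite disjoint_sym disjoints_subset setDE subIset // setCS sXZ orbT.
Qed.

Section LocalMaximumIndependent.

Variables (V : finType) (adj : rel V).
Hypothesis adj_sym : symmetric adj.
Implicit Types (S T X Y I : {set V}).

Local Notation "N[ X ]" := (closed_nbhd adj X) (format "N[ X ]").

Lemma independentP S :
  reflect {in S &, forall x y, ~~ adj x y} (independent adj S).
Proof.
apply: (iffP forall_inP) => [H x y xS yS|H x xS].
  by move/forall_inP: (H x xS); apply.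
by apply/forall_inP => y yS; apply: H.
Qed.

Lemma independentS X Y : X \subset Y -> independent adj Y -> independent adj X.
Proof.
move=> /subsetP sXY /independentP H; apply/independentP => x y xX yX.
by apply: H; apply: sXY.
Qed.

Lemma independentU X Y :
    independent adj X -> independent adj Y ->
    {in X & Y, forall x y, ~~ adj x y} ->
  independent adj (X :|: Y).
Proof.
move=> /independentP iX /independentP iY H; apply/independentP => x y.
rewrite !inE => /orP[] xin /orP[] yin; [exact: iX|exact: H| |exact: iY].
by rewrite adj_sym; apply: H.
Qed.

Lemma closed_nbhdU X Y : N[X :|: Y] = N[X] :|: N[Y].
Proof.
apply/setP => v; rewrite !inE.
have -> : [exists x in X :|: Y, adj x v] =
          [exists x in X, adj x v] || [exists x in Y, adj x v].
  apply/exists_inP/orP => [[x]|[] /exists_inP[x xin axv]].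
  - by rewrite inE => /orP[] xin axv; [left|right]; apply/exists_inP; exists x.
  - by exists x; rewrite // inE xin.
  - by exists x; rewrite // inE xin orbT.
by rewrite orbACA.
Qed.

Lemma closed_nbhdS X Y : X \subset Y -> N[X] \subset N[Y].
Proof. by move=> /setUidPr <-; rewrite closed_nbhdU subsetUl. Qed.

Lemma sub_closed_nbhd X : X \subset N[X].
Proof. exact: subsetUl. Qed.

Lemma notin_closed_nbhd X x y : x \notin N[X] -> y \in X -> ~~ adj x y.
Proof.
rewrite !inE negb_or => /andP[_ /exists_inPn H] yX.
by rewrite adj_sym; apply: H.
Qed.

(** The condition [S \subset N[S]] holds for every [S], so only independence and maximality
    remain. *)
Lemma PsiP S :
  reflect (independent adj S /\
           forall I, I \subset N[S] -> independent adj I -> #|I| <= #|S|)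
          (S \in Psi adj).
Proof.
rewrite inE /maximum_independent_in /independent_in sub_closed_nbhd /=.
apply: (iffP andP) => -[iS H]; split=> //.
  by move=> I sI iI; move/forallP/(_ I): H; rewrite sI iI.
by apply/forallP => I; apply/implyP => /andP[]; apply: H.
Qed.

(** The closed neighborhood of the empty set is empty. This gives nonemptiness of the family. *)
Lemma set0_Psi : set0 \in Psi adj.
Proof.
apply/PsiP; split; first by apply/independentP => x y; rewrite inE.
move=> I sI _; apply: subset_leq_card; apply: subset_trans sI _.
apply/subsetP => v; rewrite !inE /= => /exists_inP[x].
by rewrite inE.
Qed.

Lemma leq_card_Psi_closed_nbhd S T : S \in Psi adj -> T \in Psi adj ->
  #|S :&: N[T]| <= #|T :&: N[S]|.
Proof.
move=> /PsiP[iS _] /PsiP[iT maxT].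
have sub : (S :&: N[T]) :|: (T :\: N[S]) \subset N[T].
  rewrite subUset subsetIr /=.
  exact: subset_trans (subsetDl _ _) (sub_closed_nbhd T).
have /(maxT _ sub) : independent adj ((S :&: N[T]) :|: (T :\: N[S])).
  apply: independentU.
  - exact: independentS (subsetIl _ _) iS.
  - exact: independentS (subsetDl _ _) iT.
  - move=> x y /setIP[xS _] /setDP[_ yNS].
    by rewrite adj_sym; apply: notin_closed_nbhd xS.
(* Both sides of the bound now contain the part of [T] outside [N[S]], which cancels. *)
rewrite card_setU_setD; last by rewrite subIset // sub_closed_nbhd.
by rewrite -(cardsID N[S] T) leq_add2r.
Qed.

Lemma eq_card_Psi_closed_nbhd S T : S \in Psi adj -> T \in Psi adj ->
  #|S :&: N[T]| = #|T :&: N[S]|.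
Proof.
by move=> SP TP; apply/eqP; rewrite eqn_leq !leq_card_Psi_closed_nbhd.
Qed.

(** Maximality of [T] controls a competitor inside [N[T]], maximality of [S] outside it. Exchanging
    [S] and [T] covers the other augmented set. *)
Lemma Psi_setU_diff_closed_nbhd S T : S \in Psi adj -> T \in Psi adj ->
  T :|: (S :\: N[T]) \in Psi adj.
Proof.
move=> SP TP; have cardST := leq_card_Psi_closed_nbhd S T SP TP.
move: SP TP => /PsiP[iS maxS] /PsiP[iT maxT]; apply/PsiP; split.
  apply: independentU => //; first exact: independentS (subsetDl _ _) iS.
  by move=> x y xT /setDP[_ yNT]; rewrite adj_sym; apply: notin_closed_nbhd xT.
move=> I sI iI.
have leT : #|I :&: N[T]| <= #|T|.
  by apply: maxT (subsetIr _ _) _; apply: independentS (subsetIl _ _) iI.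
(* A vertex of [I] outside [N[T]] must lie in the closed neighborhood of [S :\: N[T]], hence in
   [N[S]]. *)
have sub : (T :&: N[S]) :|: (I :\: N[T]) \subset N[S].
  rewrite subUset subsetIr subDset /=.
  apply: subset_trans sI _; rewrite closed_nbhdU setUS //.
  exact: closed_nbhdS (subsetDl _ _).
have /(maxS _ sub) : independent adj ((T :&: N[S]) :|: (I :\: N[T])).
  apply: independentU.
  - exact: independentS (subsetIl _ _) iT.
  - exact: independentS (subsetDl _ _) iI.
  - move=> x y /setIP[xT _] /setDP[_ yNT].
    by rewrite adj_sym; apply: notin_closed_nbhd xT.
rewrite card_setU_setD; last by rewrite subIset // sub_closed_nbhd.
rewrite card_setU_setD ?sub_closed_nbhd //.
rewrite -(cardsID N[T] S) -(cardsID N[T] I) => leS; apply: leq_add => //.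
(* What is left after [leS] is [cardST] with [#|S :\: N[T]|] added to both sides. *)
rewrite -(leq_add2l #|T :&: N[S]|); apply: leq_trans leS _.
by rewrite leq_add2r.
Qed.

End LocalMaximumIndependent.

Theorem theorem1p1 (V : finType) (adj : rel V)
    (adj_sym : symmetric adj) (adj_irrefl : irreflexive adj) :
  augmentoid (Psi adj).
Proof.
split; first by apply/set0Pn; exists set0; apply: set0_Psi.
move=> S T SP TP.
exists (S :\: closed_nbhd adj T), (T :\: closed_nbhd adj S).
(* The inclusions hold because each set lies in its closed neighborhood. *)
split; rewrite ?setDS ?sub_closed_nbhd ?Psi_setU_diff_closed_nbhd //.
rewrite !card_setU_setD ?sub_closed_nbhd //.
(* Each side becomes the two outer differences plus one of the two equal intersections. *)
rewrite -(cardsID (closed_nbhd adj S) T) -(cardsID (closed_nbhd adj T) S).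
by rewrite (eq_card_Psi_closed_nbhd _ _ adj_sym S T SP TP) addnAC.
Qed.
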